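(* Let $0<\alpha\le 1$, let $k\ge 1$ be an integer, let $\lambda_1,\dots,\lambda_k>0$, and let $\{M^{\alpha}(t)\}_{t\ge0}$ be the generalized fractional counting process (GFCP) with these parameters. For $r\ge1$ and $t\ge 0$, the $r$th factorial moment $$\psi^\alpha(r,t)=\mathbb{E}\big(M^{\alpha}(t)(M^{\alpha}(t)-1)\cdots(M^{\alpha}(t)-r+1)\big)$$ is given by $$\psi^\alpha(r,t)=r!\sum_{n=1}^{r}\frac{t^{n\alpha}}{\Gamma(n\alpha+1)}\sum_{\substack{m_1+\dots+m_n=r\\ m_i\in\mathbb{N}}}\ \prod_{\ell=1}^{n}\left(\frac{1}{m_\ell!}\sum_{j=1}^{k}(j)_{m_\ell}\lambda_{j}\right),$$ where $(j)_{m}=j(j-1)\cdots(j-m+1)$ denotes the falling factorial and $\mathbb{N}=\{1,2,\dots\}$.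
   Context: The generalized fractional counting process (GFCP) $\{M^\alpha(t)\}_{t\ge0}$ with parameters $0<\alpha\le1$ and $\lambda_1,\dots,\lambda_k>0$ has non-negative integer values and its state probabilities $p^\alpha(n,t)=\mathrm{Pr}\{M^\alpha(t)=n\}$ satisfy, with $\Lambda=\lambda_1+\dots+\lambda_k$, $$\frac{\mathrm{d}^{\alpha}}{\mathrm{d}t^{\alpha}}p^\alpha(n,t)=-\Lambda p^\alpha(n,t)+\sum_{j=1}^{\min\{n,k\}}\lambda_{j}p^\alpha(n-j,t),\quad n\ge0,$$ with $p^\alpha(0,0)=1$ and $p^\alpha(n,0)=0$ for $n\ge1$. Here the Caputo derivative is $\frac{\mathrm{d}^{\alpha}}{\mathrm{d}t^{\alpha}}f(t)=\frac{1}{\Gamma(1-\alpha)}\int_0^t (t-s)^{-\alpha}f'(s)\,\mathrm{d}s$ for $0<\alpha<1$, and $f'(t)$ for $\alpha=1$. Equivalently, for $\alpha=1$, $M^1(t)=M(t)$ is the compound Poisson process with jumps of sizes $1,\dots,k$ occurring at rates $\lambda_1,\dots,\lambda_k$ respectively; for $0<\alpha<1$, $M^\alpha(t)\overset{d}{=}M(Y_\alpha(t))$, where $\{Y_\alpha(t)\}_{t\ge0}$ is an inverse $\alpha$-stable subordinator independent of $M$: $Y_\alpha(t)=\inf\{x>0: D_\alpha(x)>t\}$, with $\{D_\alpha(t)\}_{t\ge0}$ the non-decreasing Lévy process satisfying $\mathbb{E}(e^{-sD_\alpha(t)})=e^{-ts^\alpha}$, $s>0$. *)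

(* Defs.v *)
From HB Require Import structures.
From mathcomp Require Import all_boot all_order all_algebra.
From mathcomp Require Import all_classical all_reals all_analysis.

Set Implicit Arguments.
Unset Strict Implicit.
Unset Printing Implicit Defensive.

Import Order.TTheory GRing.Theory Num.Theory.
Import numFieldNormedType.Exports.

Local Open Scope classical_set_scope.
Local Open Scope ring_scope.

Definition Gamma {R : realType} (a : R) : R :=
  \int[@lebesgue_measure R]_(x in `]0, +oo[) (x `^ (a - 1) * expR (- x)).

(* Absolute continuity on every [0, T], in the form of the fundamental theorem
   of calculus for the Lebesgue integral.  This is the usual domain of the
   Caputo derivative: it allows f' to be unbounded near 0 (for 0 < alpha < 1 the
   state probabilities behave like t ^ alpha there), and it contains the
   functions continuous on [0, +oo[ that are differentiable on ]0, +oo[ with a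
   locally integrable derivative. *)
Definition locally_absolutely_continuous {R : realType} (f : R -> R) : Prop :=
  forall t : R, 0 < t ->
    [/\ {ae @lebesgue_measure R, forall s, 0 < s < t -> derivable f s 1},
        (@lebesgue_measure R).-integrable `]0, t[ (EFin \o derive1 f) &
        f t = f 0 + \int[@lebesgue_measure R]_(s in `]0, t[) derive1 f s].

(* The Caputo derivative of order alpha of f at t > 0 exists and equals d.
   Existence is part of the statement, as Rintegral and derive1 are total. *)
Definition is_caputo_derive {R : realType} (alpha : R) (f : R -> R) (t d : R) :
    Prop :=
  if alpha == 1 then is_derive t 1 f d
  else (@lebesgue_measure R).-integrable `]0, t[
         (fun s => ((t - s) `^ (- alpha) * derive1 f s)%:E) /\
       (Gamma (1 - alpha))^-1 *
         \int[@lebesgue_measure R]_(s in `]0, t[)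
           ((t - s) `^ (- alpha) * derive1 f s) = d.

Definition state_prob {d : measure_display} {T : measurableType d}
    {R : realType} (P : probability T R) (M : R -> {RV P >-> nat})
    (n : nat) (t : R) : R :=
  fine (P (M t @^-1` [set n])).

(* The rates are lambda 1, ..., lambda k; other values of lambda are unused.
   Likewise the process is only looked at for times t >= 0. The equation is
   required for t > 0 only: at t = 0 it fails for 0 < alpha < 1, the integral
   defining the Caputo derivative being over an empty interval. *)
Record is_GFCP {d : measure_display} {T : measurableType d} {R : realType}
    (P : probability T R) (alpha : R) (k : nat) (lambda : nat -> R)
    (M : R -> {RV P >-> nat}) : Prop := IsGFCP {
  GFCP_regular : forall n, locally_absolutely_continuous (state_prob M n) ;
  GFCP_init : forall n, state_prob M n 0 = (n == 0%N)%:R ;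
  GFCP_equation : forall n (t : R), 0 < t ->
    is_caputo_derive alpha (state_prob M n) t
      (- (\sum_(1 <= j < k.+1) lambda j) * state_prob M n t +
       \sum_(1 <= j < (minn n k).+1) lambda j * state_prob M (n - j) t) }.

(* Main.v *)
Require Import Defs.
From HB Require Import structures.
From mathcomp Require Import all_boot all_order all_algebra.
From mathcomp Require Import all_classical all_reals all_analysis.
From mathcomp Require Import measurable_realfun ring lra zify.

Set Implicit Arguments.
Unset Strict Implicit.
Unset Printing Implicit Defensive.

Import Order.TTheory GRing.Theory Num.Theory.
Import numFieldNormedType.Exports.

Local Open Scope classical_set_scope.
Local Open Scope ring_scope.

Local Notation mu := (@lebesgue_measure _).

(** Write p_n(t) for the state probabilities, a_m for the sum over j of
    lambda_j * binom(j, m), and I for the Riemann-Liouville integral of order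
    alpha, the convolution with x^(alpha - 1) / Gamma(alpha).

    Applying I to the Caputo equation turns it into the Volterra equation
    p_n = [n = 0] + I (- Lambda p_n + sum_j lambda_j p_(n-j))
    ([caputo_volterra]).  The kernels x^(a - 1) / Gamma(a) form a convolution
    semigroup, by Euler's formula for the Beta integral ([rl_kernel_conv]), so
    I undoes the fractional part of the Caputo derivative and maps
    e_n(t) = t^(n alpha) / Gamma(n alpha + 1) to e_(n+1).

    Multiply the Volterra equation by binom(n, r), sum over n, and use
    Vandermonde's identity for binom(n + j, r): the term of order r cancels
    against Lambda, and the binomial moments phi_r = E binom(M, r) should obey
    phi_r = [r = 0] + sum_(0 < m <= r) a_m I phi_(r-m).
    This is a recursion on r.  Starting from phi_0 = 1 = e_0, its solution is
    phi_r = sum_n c(n, r) e_n, where c(n, r) is the coefficient of u^r in the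
    n-th power of A(u) = sum_(m > 0) a_m u^m; expanding that power gives the sum
    over compositions of r into n parts.

    The cancellation presupposes finite moments, so it is carried out on sums
    over n < N, where it leaves a boundary term: the flux of the jumps across
    the level N ([trunc_moment_volterra]).  That term is nonnegative and enters
    with a minus sign, hence truncated moments never exceed the formula, by
    induction on r ([trunc_moment_le]).  This a priori bound, applied at orders
    r and r + 1, in turn makes the flux O(1/N), and a second induction gives the
    opposite inequality up to O(1/N) ([moment_gap_le]). *)

(** * The Gamma function and Euler's convolution identity *)

(** The image of c times Lebesgue measure under x |-> c x + d gives each interval
    its length, so it is Lebesgue measure itself. *)
Lemma ge0_integral_affine (R : realType) (c d : R) (f : R -> \bar R) :
  0 < c -> measurable_fun [set: R] f -> (forall x, 0 <= f x)%E ->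
  (\int[mu]_x f x = c%:E * \int[mu]_x f (c * x + d)%R)%E.
Proof.
move=> c0 mf f0.
pose phi := (fun x : R => c * x + d).
have mphi : measurable_fun [set: R] (phi : measurableTypeR R -> measurableTypeR R).
  by apply: measurable_funD => //; exact: measurable_funM.
have c0' : 0 <= c by exact: ltW.
pose nu := mscale (NngNum c0') (@lebesgue_measure R).
transitivity (\int[pushforward nu (phi : measurableTypeR R -> measurableTypeR R)]_x f x)%E.
  apply: eq_measure_integral => A mA _.
  apply: (@lebesgue_measure_unique R (pushforward nu (phi : measurableTypeR R -> measurableTypeR R))) => //.
  move=> _ [[a b] _ <-].
  rewrite /pushforward /= /mscale /=.
  rewrite [X in (_ = _ * lebesgue_measure X)%E](_ : _ = `](a - d) / c, (b - d) / c]%classic); last first.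
    apply/seteqP; split => x /=; rewrite !in_itv/= /phi ltr_pdivrMr// ler_pdivlMr//;
      by rewrite ltrBlDr lerBrDr mulrC.
  rewrite !lebesgue_measure_itv/= !lte_fin ltr_pM2r ?invr_gt0// ltrD2r.
  case: ifPn => ab; last by rewrite mule0.
  rewrite -!EFinD -EFinM; congr EFin. by field; exact: lt0r_neq0.
rewrite ge0_integral_pushforward// preimage_setT.
by rewrite ge0_integral_mscale//; [exact: (measurableT_comp mf mphi)|move=> x _; exact: f0].
Qed.

(** The truncated power x_+^(a-1).  Vanishing off the positive half-line, it turns
    integrals over ]0, t[ into convolutions over the whole line; the test is
    needed because [powR] is 1 at negative arguments. *)
Definition power_kernel (R : realType) (a x : R) : R :=
  if 0 < x then x `^ (a - 1) else 0.

Lemma power_kernel_ge0 (R : realType) (a x : R) : 0 <= power_kernel a x.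
Proof. by rewrite /power_kernel; case: ifP => // _; exact: powR_ge0. Qed.

Lemma measurable_power_kernel (R : realType) (a : R) :
  measurable_fun [set: R] (power_kernel a).
Proof.
by apply: measurable_fun_ifT => //; exact: measurable_fun_ltr.
Qed.

Lemma measurable_power_kernel_sub (R : realType) (a t : R) :
  measurable_fun [set: R] (fun u : R => power_kernel a (t - u)).
Proof.
apply: measurableT_comp; first exact: measurable_power_kernel.
exact: measurable_funB.
Qed.

Lemma power_kernel_mul (R : realType) (a c x : R) : 0 < c ->
  power_kernel a (c * x) = c `^ (a - 1) * power_kernel a x.
Proof.
move=> c0; rewrite /power_kernel pmulr_rgt0//; case: ifPn => [x0|_].
  by rewrite powRM// ltW.
by rewrite mulr0.
Qed.

Lemma power_kernel1E (R : realType) (x : R) :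
  power_kernel 1 x = (0 < x)%R%:R.
Proof. by rewrite /power_kernel subrr powRr0; case: ifP. Qed.

(** The primitive x^a / a bounds the integral over each [1/(n+1), 1] by 1/a; these
    segments exhaust ]0, 1]. *)
Lemma integral_power_kernel01_lty (R : realType) (a : R) : 0 < a ->
  (\int[mu]_(x in `]0%R, 1%R]) (power_kernel a x)%:E < +oo)%E.
Proof.
move=> a0.
pose F := fun n : nat => `[(n.+1%:R : R)^-1, 1]%classic.
have F01 : `]0, 1]%classic = \bigcup_n F n.
  apply/seteqP; split => x.
    rewrite /= in_itv/= => /andP[x0 x1].
    have [n nx] : exists n, x^-1 < n.+1%:R.
      exists (Num.truncn x^-1); exact: truncnS_gt.
    exists n => //; rewrite /F/= in_itv/= x1 andbT.
    by rewrite invf_ple ?posrE// ltW.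
  move=> [n _]; rewrite /F/= !in_itv/= => /andP[nx ->]; rewrite andbT.
  exact: lt_le_trans nx.
have mk : forall D : set R, measurable_fun D (fun x => (power_kernel a x)%:E).
  by move=> D; apply/measurable_EFinP; apply: measurable_funTS; exact: measurable_power_kernel.
have k0 x : (0 <= (power_kernel a x)%:E)%E by rewrite lee_fin power_kernel_ge0.
have cvF : (\int[mu]_(x in F i) (power_kernel a x)%:E @[i --> \oo] -->
    \int[mu]_(x in \bigcup_i F i) (power_kernel a x)%:E)%E.
  apply: ge0_nondecreasing_set_cvg_integral => //.
  - apply/nondecreasing_seqP => n; rewrite subsetEset /F.
    apply: subset_itvr; rewrite bnd_simp lef_pV2 ?posrE// ler_nat//.
  - by move=> n; exact: measurable_itv.
  - by move=> n; exact: mk.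
rewrite F01 -(cvg_lim _ cvF)//.
apply: (@le_lt_trans _ _ (a^-1)%:E); last exact: ltry.
apply: lime_le; first by apply/cvg_ex; eexists; exact: cvF.
apply: nearW => -[|n].
  rewrite /F /= invr1 set_itv1 integral_set1 lee_fin invr_ge0; exact: ltW.
have n1 : (n.+2%:R : R)^-1 < 1 by rewrite invf_lt1// ltr1n.
have n0 : 0 < (n.+2%:R : R)^-1 by rewrite invr_gt0.
rewrite (@eq_integral _ _ _ mu _ (fun x => (x `^ (a - 1))%:E)); last first.
  move=> x; rewrite inE /F/= in_itv/= => /andP[nx _].
  by rewrite /power_kernel (lt_le_trans n0 nx).
have cp (b x : R) : 0 < x -> {for x, continuous (fun y : R => y `^ b)}.
  move=> x0; apply: differentiable_continuous; apply/derivable1_diffP.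
  by apply: derivable_powR; rewrite in_itv/= x0.
rewrite (@continuous_FTC2 _ _ (fun x => a^-1 * x `^ a))//.
- rewrite -EFinB lee_fin powR1 mulr1 gerBl mulr_ge0 ?powR_ge0// invr_ge0 ltW//.
- apply: continuous_in_subspaceT => x; rewrite inE/= in_itv/= => /andP[nx _].
  by apply: cp; exact: lt_le_trans nx.
- have d1 (x : R) : 0 < x -> derivable (fun x => a^-1 * x `^ a) x 1.
    move=> x0; apply: derivableM => //.
    by apply: derivable_powR; rewrite in_itv/= x0.
  have c1 (x : R) : 0 < x -> {for x, continuous (fun x => a^-1 * x `^ a)}.
    by move=> /d1 ?; apply: differentiable_continuous; apply/derivable1_diffP.
  split.
  + by move=> x; rewrite in_itv/= => /andP[nx _]; apply: d1; exact: lt_trans nx.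
  + apply: cvg_at_right_filter; exact: c1.
  + apply: cvg_at_left_filter; exact: c1.
- move=> x; rewrite in_itv/= => /andP[nx _].
  have x0 : 0 < x by exact: lt_trans nx.
  rewrite derive1Ml; last by apply: derivable_powR; rewrite in_itv/= x0.
  rewrite powR_derive1 ?in_itv/= ?x0// mulrA mulVf ?mul1r//; exact: lt0r_neq0.
Qed.

(** Follows from ln y <= y - 1 at y = x / (2a). *)
Lemma gamma_integrand_bound (R : realType) (a x : R) : 0 < a -> 1 <= x ->
  x `^ (a - 1) * expR (- x) <= expR (a * (ln (2 * a) - 1)) * expR (- (x / 2)).
Proof.
move=> a0 x1; have x0 : 0 < x by exact: lt_le_trans x1.
apply: (@le_trans _ _ (x `^ a * expR (- x))).
  by rewrite ler_wpM2r ?expR_ge0// ler_powR// gerBl.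
rewrite /powR gt_eqF// -!expRD ler_expR.
have a2 : 0 < 2 * a by rewrite mulr_gt0.
have : ln (x / (2 * a)) <= x / (2 * a) - 1.
  have := @le_ln1Dx _ (x / (2 * a) - 1); rewrite subrKC; apply.
  by rewrite ltrBrDr addrC subrr divr_gt0.
rewrite ln_div ?posrE// => h.
have : a * ln x <= a * (x / (2 * a) - 1 + ln (2 * a)).
  by rewrite ler_wpM2l ?(ltW a0)// -lerBlDr.
have -> : a * (x / (2 * a) - 1 + ln (2 * a)) = x / 2 + a * (ln (2 * a) - 1).
  by field; exact: lt0r_neq0.
lra.
Qed.

Lemma measurable_gamma_integrand (R : realType) (a : R) :
  measurable_fun [set: R] (fun x : R => power_kernel a x * expR (- x)).
Proof.
apply: measurable_funM; first exact: measurable_power_kernel.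
by apply: measurableT_comp => //; exact: measurable_funN.
Qed.

(** [Gamma] is the real part of an extended integral, equal to it only once that
    integral is known to be finite: near 0 compare with x^(a-1), near infinity
    with the exponential density of rate 1/2. *)
Lemma integral_GammaE (R : realType) (a : R) : 0 < a ->
  (\int[mu]_x (power_kernel a x * expR (- x))%:E = (Gamma a)%:E)%E.
Proof.
move=> a0.
have -> : Gamma a = fine (\int[mu]_x (power_kernel a x * expR (- x))%:E)%E.
  rewrite /Gamma /Rintegral integral_mkcond; congr fine.
  apply: eq_integral => x _; rewrite patchE /power_kernel.
  case: ifPn; rewrite ?inE/= ?notin_setE/= in_itv/= andbT.
    by move=> ->.
  by move=> /negP/negbTE ->; rewrite mul0r.
rewrite fineK// ge0_fin_numE; last first.
  by apply: integral_ge0 => x _; rewrite lee_fin mulr_ge0 ?expR_ge0 ?power_kernel_ge0.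
(* Dominate the integrand by h1 + h2, splitting at 1; the factor 2 in h2 undoes
   the rate 1/2 in front of the exponential density. *)
pose h1 : R -> R := power_kernel a \_ `]0, 1].
pose C := expR (a * (ln (2 * a) - 1)).
pose h2 : R -> R := fun x => C * 2 * exponential_pdf (2^-1) x.
have h10 x : 0 <= h1 x by rewrite /h1 patchE; case: ifP => // _; exact: power_kernel_ge0.
have h20 x : 0 <= h2 x.
  by rewrite /h2 mulr_ge0 ?exponential_pdf_ge0// mulr_ge0// expR_ge0.
have mh1 : measurable_fun [set: R] h1.
  apply/(measurable_restrictT _ _).1 => //.
  by apply: measurable_funTS; exact: measurable_power_kernel.
have mh2 : measurable_fun [set: R] h2.
  by apply: measurable_funM => //; exact: measurable_exponential_pdf.
apply: (@le_lt_trans _ _ (\int[mu]_x ((h1 x)%:E + (h2 x)%:E))%E).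
  apply: ge0_le_integral => //.
  - by move=> x _; rewrite lee_fin mulr_ge0 ?expR_ge0 ?power_kernel_ge0.
  - by apply/measurable_EFinP; exact: measurable_gamma_integrand.
  - by apply: emeasurable_funD; apply/measurable_EFinP.
  - move=> x _; rewrite -EFinD lee_fin.
    have [x0|x0] := ltP 0 x; last first.
      by rewrite /power_kernel ltNge x0/= mul0r addr_ge0.
    have [x1|x1] := leP x 1.
      rewrite /h1 patchE ifT ?inE/= ?in_itv/= ?x0 ?x1//.
      apply: (@le_trans _ _ (power_kernel a x)); last by rewrite lerDl.
      rewrite ger_pMr; first by rewrite -expR0 ler_expR oppr_le0 ltW.
      by rewrite /power_kernel x0 powR_gt0.
    apply: (@le_trans _ _ (h2 x)); last by rewrite lerDr.
    rewrite /power_kernel x0 /h2 exponential_pdfE ?(ltW x0)// mulNr.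
    apply: (le_trans (gamma_integrand_bound a0 (ltW x1))).
    by rewrite -/C [x / 2]mulrC mulrA mulfK.
rewrite ge0_integralD//; [|by move=> x _; rewrite lee_fin|exact/measurable_EFinP
  |by move=> x _; rewrite lee_fin|exact/measurable_EFinP].
apply: lte_add_pinfty.
  rewrite (_ : (\int[mu]_x (h1 x)%:E)%E =
      (\int[mu]_(x in `]0%R, 1%R]) (power_kernel a x)%:E)%E).
    exact: integral_power_kernel01_lty.
  rewrite [RHS]integral_mkcond; apply: eq_integral => x _.
  by rewrite /h1 !patchE; case: ifP.
rewrite /h2; under eq_integral do rewrite EFinM.
rewrite ge0_integralZl//.
- by rewrite integral_exponential_pdf// mule1 ltry.
- by apply/measurable_EFinP; exact: measurable_exponential_pdf.
- by move=> x _; rewrite lee_fin exponential_pdf_ge0.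
- by rewrite lee_fin mulr_ge0// expR_ge0.
Qed.

Lemma Gamma_gt0 (R : realType) (a : R) : 0 < a -> 0 < Gamma a.
Proof.
move=> a0; rewrite -lte_fin -integral_GammaE//.
have G0 x : (0 <= (power_kernel a x * expR (- x))%:E)%E.
  by rewrite lee_fin mulr_ge0 ?expR_ge0 ?power_kernel_ge0.
have mG (D : set R) : measurable_fun D (fun x : R => (power_kernel a x * expR (- x))%:E).
  by apply/measurable_EFinP; apply: measurable_funTS; exact: measurable_gamma_integrand.
apply: (@lt_le_trans _ _ (\int[mu]_(x in `[1%R, 2%R]) (2^-1 * expR (- 2))%:E)%E); last first.
  apply: (@le_trans _ _
    (\int[mu]_(x in `[1%R, 2%R]) (power_kernel a x * expR (- x))%:E)%E).
    apply: ge0_le_integral => //.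
    - exact: mG.
    - move=> x; rewrite /= in_itv/= => /andP[x1 x2].
      have x0 : 0 < x by exact: lt_le_trans x1.
      rewrite lee_fin; apply: ler_pM; rewrite ?expR_ge0 ?ler_expR ?lerN2//.
      rewrite /power_kernel x0 powRB ?(gt_eqF x0) ?implybT// powRr1 ?(ltW x0)//.
      rewrite ler_pdivlMr// mulrC ler_pdivrMr//.
      apply: (le_trans x2); rewrite ler_peMl//.
      by rewrite -(powRr0 x) ler_powR// ltW.
  apply: ge0_subset_integral => //; first exact: mG.
rewrite integral_cst//= lebesgue_measure_itv/= lte_fin ltr1n/= -EFinB -EFinM lte_fin.
by rewrite !mulr_gt0 ?expR_gt0// ?invr_gt0// subr_gt0 ltr1n.
Qed.

Lemma Gamma1 (R : realType) : Gamma (1 : R) = 1.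
Proof.
rewrite /Gamma /Rintegral subrr -[RHS]/(fine 1%E) -(@integral_exponential_pdf R 1)//.
congr fine; rewrite integral_itv_obnd_cbnd; last first.
  apply/measurable_EFinP; apply: measurable_funM; first exact: measurable_funTS.
  apply: measurable_funTS.
  by apply: measurableT_comp => //; exact: measurable_funN.
rewrite integral_mkcond; apply: eq_integral => x _.
rewrite patchE /exponential_pdf patchE; case: ifPn => // _.
by rewrite powRr0 mulN1r.
Qed.

(** Homogeneity: substitute u = z v. *)
Lemma power_kernel_convE (R : realType) (a b z : R) :
  (\int[mu]_u (power_kernel a (z - u) * power_kernel b u)%:E =
   (power_kernel (a + b) z)%:E *
     \int[mu]_u (power_kernel a (1 - u) * power_kernel b u)%:E)%E.
Proof.
have mk (y : R) : measurable_fun [set: R]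
    (fun u => (power_kernel a (y - u) * power_kernel b u)%:E).
  apply/measurable_EFinP; apply: measurable_funM; last exact: measurable_power_kernel.
  exact: measurable_power_kernel_sub.
have k0 (y u : R) : (0 <= (power_kernel a (y - u) * power_kernel b u)%:E)%E.
  by rewrite lee_fin mulr_ge0 ?power_kernel_ge0.
have [z0|z0] := ltP 0 z; last first.
  have -> : power_kernel (a + b) z = 0 by rewrite /power_kernel ltNge z0.
  rewrite mul0e integral0_eq// => u _.
  rewrite /power_kernel subr_gt0; case: ifPn => [uz|]; last by rewrite mul0r.
  by rewrite ltNge (le_trans (ltW uz) z0)/= mulr0.
rewrite (@ge0_integral_affine R z 0 _ z0 (mk z) (k0 z)).
under eq_integral => u _.
  rewrite addr0 (_ : (z - z * u = z * (1 - u))%R); last by ring.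
  rewrite !power_kernel_mul// mulrACA EFinM; over.
rewrite ge0_integralZl//; [|exact: (mk 1)
  |by rewrite lee_fin mulr_ge0 ?powR_ge0].
rewrite muleA -EFinM; congr ((_)%:E * _)%E.
have -> : power_kernel (a + b) z = z `^ (a + b - 1) by rewrite /power_kernel z0.
rewrite -powRD ?(gt_eqF z0) ?implybT// mulrC.
rewrite -[X in _ * X](powRr1 (ltW z0)) -powRD ?(gt_eqF z0) ?implybT//.
by congr (_ `^ _); ring.
Qed.

(** Euler's Beta integral.  Integrate the convolution of two truncated powers
    against exp(-z): by Tonelli and translation the result is
    Gamma(a) Gamma(b), while by homogeneity it is Gamma(a + b) times the
    convolution at 1. *)
Lemma power_kernel_conv (R : realType) (a b z : R) : 0 < a -> 0 < b ->
  (\int[mu]_u (power_kernel a (z - u) * power_kernel b u)%:E =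
   (Gamma a * Gamma b / Gamma (a + b) * power_kernel (a + b) z)%:E)%E.
Proof.
move=> a0 b0; have ab0 : 0 < a + b by exact: addr_gt0.
rewrite power_kernel_convE.
set B := (\int[mu]_u (power_kernel a (1 - u) * power_kernel b u)%:E)%E.
have B0 : (0 <= B)%E.
  by apply: integral_ge0 => u _; rewrite lee_fin mulr_ge0 ?power_kernel_ge0.
suff : ((Gamma (a + b))%:E * B = (Gamma a * Gamma b)%:E)%E.
  have G0 := Gamma_gt0 ab0.
  case: B B0 => [B' _|_|//].
    rewrite -!EFinM => -[<-]; congr EFin.
    by field; exact: lt0r_neq0.
  by rewrite gt0_muley.
pose f := fun zu : R * R =>
  (power_kernel a (zu.1 - zu.2) * power_kernel b zu.2 * expR (- zu.1))%:E.
have mf : measurable_fun [set: R * R] f.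
  apply/measurable_EFinP; apply: measurable_funM.
    apply: measurable_funM.
      apply: measurableT_comp; first exact: measurable_power_kernel.
      exact: measurable_funB.
    by apply: measurableT_comp => //; exact: measurable_power_kernel.
  apply: measurableT_comp => //; exact: measurable_funN.
have f0 x : (0 <= f x)%E.
  by rewrite lee_fin !mulr_ge0 ?power_kernel_ge0 ?expR_ge0.
have := @fubini_tonelli _ _ _ _ _ mu mu f mf f0.
have mG (c : R) : measurable_fun [set: R]
    (fun x => (power_kernel c x * expR (- x))%:E).
  by apply/measurable_EFinP; exact: measurable_gamma_integrand.
have G0 (c x : R) : (0 <= (power_kernel c x * expR (- x))%:E)%E.
  by rewrite lee_fin mulr_ge0 ?expR_ge0 ?power_kernel_ge0.
have mk (y : R) : measurable_fun [set: R]
    (fun u => (power_kernel a (y - u) * power_kernel b u)%:E).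
  apply/measurable_EFinP; apply: measurable_funM; last exact: measurable_power_kernel.
  exact: measurable_power_kernel_sub.
have -> : (\int[mu]_x \int[mu]_y f (x, y) = (Gamma (a + b))%:E * B)%E.
  transitivity (\int[mu]_x ((power_kernel (a + b) x * expR (- x))%:E * B))%E.
    apply: eq_integral => x _; rewrite /f/=.
    under eq_integral do rewrite EFinM.
    rewrite ge0_integralZr//; [|exact: mk
      |by move=> u _; rewrite lee_fin mulr_ge0 ?power_kernel_ge0].
    by rewrite power_kernel_convE -/B EFinM muleAC.
  by rewrite ge0_integralZr; [rewrite integral_GammaE|exact: measurableT
    |exact: mG|move=> x _; exact: G0|].
move=> ->.
transitivity (\int[mu]_y ((Gamma a)%:E * (power_kernel b y * expR (- y))%:E))%E.
  apply: eq_integral => y _; rewrite /f/=.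
  rewrite (@ge0_integral_affine R 1 y _ ltr01); last 2 first.
  - apply/measurable_EFinP; apply: measurable_funM.
      apply: measurable_funM => //.
      apply: measurableT_comp; first exact: measurable_power_kernel.
      exact: measurable_funB.
    by apply: measurableT_comp => //; exact: measurable_funN.
  - by move=> x; exact: (f0 (x, y)).
  rewrite mul1e -integral_GammaE// -ge0_integralZr//; last exact: mG.
  apply: eq_integral => x _; rewrite -EFinM mul1r addrK opprD expRD.
  by congr EFin; ring.
by rewrite ge0_integralZl; [rewrite integral_GammaE|exact: measurableT
  |exact: mG|move=> x _; exact: G0|rewrite lee_fin ltW// Gamma_gt0].
Qed.

(** The Riemann-Liouville kernel, normalized so that convolution adds orders. *)
Definition rl_kernel (R : realType) (a x : R) : R := power_kernel a x / Gamma a.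

Lemma rl_kernel_ge0 (R : realType) (a x : R) : 0 < a -> 0 <= rl_kernel a x.
Proof. by move=> a0; rewrite mulr_ge0 ?power_kernel_ge0// invr_ge0 ltW// Gamma_gt0. Qed.

Lemma measurable_rl_kernel (R : realType) (a : R) :
  measurable_fun [set: R] (rl_kernel a).
Proof. by apply: measurable_funM => //; exact: measurable_power_kernel. Qed.

Lemma measurable_rl_kernel_sub (R : realType) (a t : R) :
  measurable_fun [set: R] (fun u : R => rl_kernel a (t - u)).
Proof. by apply: measurable_funM => //; exact: measurable_power_kernel_sub. Qed.

Lemma rl_kernel1E (R : realType) (x : R) : rl_kernel 1 x = (0 < x)%R%:R.
Proof. by rewrite /rl_kernel Gamma1 divr1 power_kernel1E. Qed.

Lemma rl_kernel_conv (R : realType) (a b s t : R) : 0 < a -> 0 < b ->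
  (\int[mu]_u (rl_kernel a (t - u) * rl_kernel b (u - s))%:E =
   (rl_kernel (a + b) (t - s))%:E)%E.
Proof.
move=> a0 b0; have ab0 : 0 < a + b by exact: addr_gt0.
have k0 (u : R) : 0 <= power_kernel a (t - s - u) * power_kernel b u.
  by rewrite mulr_ge0 ?power_kernel_ge0.
rewrite (@ge0_integral_affine R 1 s _ ltr01); last 2 first.
- apply/measurable_EFinP; apply: measurable_funM.
    exact: measurable_rl_kernel_sub.
  apply: measurableT_comp; first exact: measurable_rl_kernel.
  exact: measurable_funB.
- by move=> x; rewrite lee_fin mulr_ge0 ?rl_kernel_ge0.
rewrite mul1e; transitivity (\int[mu]_u (((Gamma a)^-1 * (Gamma b)^-1)%:E *
    (power_kernel a (t - s - u) * power_kernel b u)%:E))%E.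
  apply: eq_integral => u _; rewrite -EFinM /rl_kernel mul1r addrK.
  rewrite (_ : (t - (u + s) = t - s - u)%R); last by ring.
  by rewrite mulrACA mulrC.
rewrite ge0_integralZl//.
- rewrite power_kernel_conv// -EFinM /rl_kernel; congr EFin.
  rewrite -invfM mulrA mulrA mulVf ?mul1r 1?mulrC//.
  by rewrite mulf_neq0// lt0r_neq0// Gamma_gt0.
- apply/measurable_EFinP; apply: measurable_funM; last exact: measurable_power_kernel.
  exact: measurable_power_kernel_sub.
- by move=> u _; rewrite lee_fin.
- by rewrite lee_fin mulr_ge0// invr_ge0 ltW// Gamma_gt0.
Qed.

(** * From the Caputo equation to a Volterra equation *)

(** Such a function is an indefinite integral, hence continuous. *)
Lemma locally_absolutely_continuous_measurable (R : realType) (f : R -> R) (t : R) :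
  locally_absolutely_continuous f -> measurable_fun `]0, t[ f.
Proof.
move=> fac; have [t0|t0] := ltP 0 t; last first.
  by rewrite set_itv_ge ?bnd_simp -?leNgt//; exact: measurable_fun_set0.
have [_ iF _] := fac t t0.
pose F : R -> R := derive1 f \_ `]0, t[.
(* The indefinite integral is continuous for closed intervals; extending f' by 0
   from ]0, t[ makes its integrability there available on [0, t]. *)
have iF' : (@lebesgue_measure R).-integrable `[0, t] (EFin \o F).
  apply: (@integrableS _ _ _ _ setT) => //.
  by have /integrable_mkcond := iF; rewrite restrict_EFin; apply.
have cF := @parameterized_integral_continuous _ 0 t F (ltW t0) iF'.
have mF : measurable_fun `[0, t] (fun x => \int[@lebesgue_measure R]_(s in `[0, x]) F s).
  apply: subspace_continuous_measurable_fun => //.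
have mF' : measurable_fun `]0, t[ (fun x => f 0 + \int[@lebesgue_measure R]_(s in `[0, x]) F s).
  apply: measurable_funD => //; apply: measurable_funS mF => //.
  exact: subset_itv_oo_cc.
apply: eq_measurable_fun mF' => x; rewrite inE/= in_itv/= => /andP[x0 xt].
have [_ iFx ->] := fac x x0; congr (_ + _).
rewrite /Rintegral integral_itv_bndoo; last first.
  apply/measurable_EFinP; apply/(measurable_restrict _ _ _).1 => //.
  have mf' : measurable_fun `]0, t[ (derive1 f).
    by apply/measurable_EFinP; exact: measurable_int iF.
  by apply: measurable_funS mf' => // ? [].
congr fine; apply: eq_integral => s; rewrite inE/= in_itv/= => /andP[s0 sx].
by rewrite /F patchE ifT// inE/= in_itv/= s0 (lt_trans sx).
Qed.

(** The Riemann-Liouville fractional integral of order a. *)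
Definition rl_integral (R : realType) (a : R) (g : R -> R) (t : R) : R :=
  \int[@lebesgue_measure R]_(s in `]0, t[) (rl_kernel a (t - s) * g s).

Lemma caputo_volterra1 (R : realType) (f g : R -> R) (t : R) : 0 < t ->
  locally_absolutely_continuous f ->
  (forall t, 0 < t -> is_caputo_derive 1 f t (g t)) ->
  f t = f 0 + rl_integral 1 g t.
Proof.
move=> t0 fac fg; have [_ _ ->] := fac t t0; congr (_ + _).
apply: eq_Rintegral => s; rewrite inE/= in_itv/= => /andP[s0 st].
rewrite rl_kernel1E subr_gt0 st mul1r derive1E.
by have := fg s s0; rewrite /is_caputo_derive eqxx => h; rewrite derive_val.
Qed.

(** The Caputo derivative convolves f' with the kernel of order 1 - a; a further
    convolution with the kernel of order a produces, by Fubini and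
    [rl_kernel_conv], the kernel of order 1, which is the indicator of the
    positive half-line.  What remains is the integral of f' over ]0, t[. *)
Lemma caputo_volterra_lt1 (R : realType) (a : R) (f g : R -> R) (t : R) :
  0 < a -> a < 1 -> 0 < t ->
  locally_absolutely_continuous f ->
  (forall t, 0 < t -> is_caputo_derive a f t (g t)) ->
  f t = f 0 + rl_integral a g t.
Proof.
move=> a0 a1 t0 fac fg; have [_ iF ft] := fac t t0.
have b0 : 0 < 1 - a by rewrite subr_gt0.
pose F : R -> R := derive1 f \_ `]0, t[.
have iF' : (@lebesgue_measure R).-integrable setT (EFin \o F).
  by have /integrable_mkcond := iF; rewrite restrict_EFin; apply.
have mF : measurable_fun [set: R] F.
  by apply/measurable_EFinP; exact: measurable_int iF'.
(* u is the variable of the outer convolution, s that of the Caputo derivative. *)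
pose H := fun us : R * R =>
  (rl_kernel a (t - us.1) * rl_kernel (1 - a) (us.1 - us.2) * F us.2)%:E.
have mk (c : R) (h : R * R -> R) : measurable_fun setT h ->
    measurable_fun setT (fun us => rl_kernel c (h us)).
  by move=> mh; apply: measurableT_comp => //; exact: measurable_rl_kernel.
have mH : measurable_fun setT H.
  apply/measurable_EFinP; apply: measurable_funM; last exact: measurableT_comp.
  by apply: measurable_funM; apply: mk; exact: measurable_funB.
have mkk (s : R) : measurable_fun [set: R]
    (fun u : R => (rl_kernel a (t - u) * rl_kernel (1 - a) (u - s))%:E).
  apply/measurable_EFinP; apply: measurable_funM.
    exact: measurable_rl_kernel_sub.
  apply: measurableT_comp; first exact: measurable_rl_kernel.
  exact: measurable_funB.
have kk0 (s u : R) : 0 <= rl_kernel a (t - u) * rl_kernel (1 - a) (u - s).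
  by rewrite mulr_ge0 ?rl_kernel_ge0.
have ckk (s : R) : (\int[mu]_u (rl_kernel a (t - u) * rl_kernel (1 - a) (u - s))%:E
    = ((s < t)%R%:R)%:E)%E.
  by rewrite rl_kernel_conv// subrKC rl_kernel1E subr_gt0.
have F1 s : F s * (s < t)%R%:R = F s.
  rewrite /F patchE; case: ifPn; last by rewrite mul0r.
  by rewrite inE/= in_itv/= => /andP[_ ->]; rewrite mulr1.
have iH : (mu \x mu)%E.-integrable setT H.
  apply/integrable21ltyP => //.
  have /integrableP[_] := iF'; apply: le_lt_trans.
  rewrite le_eqVlt; apply/orP; left; apply/eqP; apply: eq_integral => s _.
  under eq_integral => u _ do rewrite /H/= normrM ger0_norm// EFinM.
  rewrite ge0_integralZr; [|exact: measurableT|exact: mkk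
    |by move=> u _; rewrite lee_fin|by rewrite lee_fin].
  by rewrite ckk /= -EFinM mulrC -[in RHS]F1 normrM normr_nat.
have E2 : (\int[mu]_y \int[mu]_x H (x, y) = (f t - f 0)%:E)%E.
  transitivity (\int[mu]_x (EFin \o F) x)%E.
    apply: eq_integral => s _; rewrite /H/=.
    under eq_integral => u _ do rewrite EFinM.
    rewrite integralZr//; last first.
      apply/integrableP; split; first exact: mkk.
      under eq_integral => u _ do rewrite /= ger0_norm//.
      by rewrite ckk ltry.
    by rewrite ckk -EFinM mulrC F1.
  rewrite ft addrAC subrr add0r /Rintegral fineK; last exact: integrable_fin_num.
  by rewrite [RHS]integral_mkcond; apply: eq_integral => x _; rewrite restrict_EFin.
have E1 : (\int[mu]_x \int[mu]_y H (x, y) =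
    \int[mu]_(u in `]0%R, t[) (rl_kernel a (t - u) * g u)%:E)%E.
  rewrite [RHS]integral_mkcond; apply: eq_integral => u _; rewrite patchE /H/=.
  case: ifPn; rewrite ?inE ?notin_setE/= in_itv/=; last first.
    move=> /negP; rewrite negb_and -!leNgt => ut.
    rewrite integral0_eq// => s _; case/orP: ut => [u0|ut]; last first.
      by rewrite /rl_kernel {1}/power_kernel subr_gt0 ltNge ut !mul0r.
    rewrite /F patchE; case: ifPn; last by rewrite mulr0.
    rewrite inE/= in_itv/= => /andP[s0 _].
    rewrite (_ : rl_kernel (1 - a) (u - s) = 0) ?mulr0 ?mul0r//.
    rewrite /rl_kernel /power_kernel subr_gt0 ifF ?mul0r//.
    by apply/negbTE; rewrite -leNgt (le_trans u0)// ltW.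
  move=> /andP[u0 ut].
  have := fg u u0; rewrite /is_caputo_derive lt_eqF// => -[iu gu].
  transitivity (\int[mu]_(s in `]0%R, u[) ((rl_kernel a (t - u) / Gamma (1 - a))%:E *
      ((u - s) `^ (- a) * derive1 f s)%:E))%E.
    rewrite [RHS]integral_mkcond; apply: eq_integral => s _; rewrite patchE.
    case: ifPn; rewrite ?inE ?notin_setE/= in_itv/=.
      move=> /andP[s0 su].
      rewrite /F patchE ifT; last by rewrite inE/= in_itv/= s0 (lt_trans su).
      have -> : rl_kernel (1 - a) (u - s) = (u - s) `^ (- a) / Gamma (1 - a).
        by rewrite /rl_kernel /power_kernel subr_gt0 su addrAC subrr sub0r.
      move: (rl_kernel _ _) (Gamma _) (_ `^ _) (derive1 f s) => x y z w.
      by rewrite -EFinM; congr EFin; rewrite -!mulrA; congr (_ * _); rewrite mulrCA.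
    move=> /negP; rewrite negb_and -!leNgt => /orP[s0|us].
      rewrite /F patchE memNset ?mulr0//=; rewrite in_itv/=.
      by apply/negP; rewrite negb_and -leNgt s0.
    rewrite (_ : rl_kernel (1 - a) (u - s) = 0) ?mulr0 ?mul0r//.
    by rewrite /rl_kernel /power_kernel subr_gt0 ltNge us mul0r.
  rewrite integralZl// -[X in (_ * X)%E]fineK; last exact: integrable_fin_num.
  by rewrite -EFinM -gu mulrA.
have := etrans (esym E1) (etrans (@Fubini _ _ _ _ _ mu mu H iH) E2).
rewrite /rl_integral /Rintegral => ->/=.
by rewrite addrC subrK.
Qed.

Lemma caputo_volterra (R : realType) (a : R) (f g : R -> R) (t : R) :
  0 < a -> a <= 1 -> 0 < t ->
  locally_absolutely_continuous f ->
  (forall t, 0 < t -> is_caputo_derive a f t (g t)) ->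
  f t = f 0 + rl_integral a g t.
Proof.
move=> a0; rewrite le_eqVlt => /predU1P[->|]; last exact: caputo_volterra_lt1.
exact: caputo_volterra1.
Qed.

(** * Calculus of the fractional integral *)

Definition rl_integrable (R : realType) (a : R) (h : R -> R) (t : R) : Prop :=
  (@lebesgue_measure R).-integrable `]0, t[ (fun s => (rl_kernel a (t - s) * h s)%:E).

Lemma rl_integrableD (R : realType) (a t : R) (h1 h2 : R -> R) :
  rl_integrable a h1 t -> rl_integrable a h2 t ->
  rl_integrable a (fun s => h1 s + h2 s) t.
Proof.
move=> i1 i2; apply: eq_integrable (integrableD _ i1 i2) => //.
by move=> s _; rewrite -EFinD -mulrDr.
Qed.

Lemma rl_integrableZ (R : realType) (a c t : R) (h : R -> R) :
  rl_integrable a h t -> rl_integrable a (fun s => c * h s) t.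
Proof.
move=> i1; apply: eq_integrable (integrableZl _ c i1) => //.
by move=> s _; rewrite -EFinM mulrCA.
Qed.

Lemma rl_integralD (R : realType) (a t : R) (h1 h2 : R -> R) :
  rl_integrable a h1 t -> rl_integrable a h2 t ->
  rl_integral a (fun s => h1 s + h2 s) t = rl_integral a h1 t + rl_integral a h2 t.
Proof.
move=> i1 i2; rewrite /rl_integral -RintegralD//.
by apply: eq_Rintegral => s _; rewrite mulrDr.
Qed.

Lemma rl_integralZ (R : realType) (a c t : R) (h : R -> R) :
  rl_integrable a h t -> rl_integral a (fun s => c * h s) t = c * rl_integral a h t.
Proof.
move=> i1; rewrite /rl_integral -RintegralZl//.
by apply: eq_Rintegral => s _; rewrite mulrCA.
Qed.

Lemma rl_integrable0 (R : realType) (a t : R) : rl_integrable a (fun=> 0) t.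
Proof.
apply: eq_integrable (integrable0 _ _) => //.
by move=> s _; rewrite mulr0.
Qed.

Lemma rl_integral0 (R : realType) (a t : R) : rl_integral a (fun=> 0) t = 0.
Proof.
rewrite /rl_integral /Rintegral integral0_eq// => s _; by rewrite mulr0.
Qed.

Lemma rl_integrable_sum (R : realType) (a t : R) (I : Type) (r : seq I)
    (P : pred I) (h : I -> R -> R) : (forall i, P i -> rl_integrable a (h i) t) ->
  rl_integrable a (fun s => \sum_(i <- r | P i) h i s) t.
Proof.
move=> ih; elim: r => [|i r IH].
  have -> : (fun s => \sum_(i <- [::] | P i) h i s) = fun=> 0.
    by apply/funext => s; rewrite big_nil.
  exact: rl_integrable0.
have [Pi|Pi] := boolP (P i); last first.
  have -> // : (fun s => \sum_(j <- i :: r | P j) h j s) =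
    (fun s => \sum_(j <- r | P j) h j s).
  by apply/funext => s; rewrite big_cons (negbTE Pi).
have -> : (fun s => \sum_(j <- i :: r | P j) h j s) =
    (fun s => h i s + \sum_(j <- r | P j) h j s).
  by apply/funext => s; rewrite big_cons Pi.
by apply: rl_integrableD => //; exact: ih.
Qed.

Lemma rl_integral_sum (R : realType) (a t : R) (I : Type) (r : seq I)
    (P : pred I) (h : I -> R -> R) : (forall i, P i -> rl_integrable a (h i) t) ->
  rl_integral a (fun s => \sum_(i <- r | P i) h i s) t =
  \sum_(i <- r | P i) rl_integral a (h i) t.
Proof.
move=> ih; elim: r => [|i r IH].
  rewrite big_nil -[RHS](rl_integral0 a t); congr (rl_integral _ _ _).
  by apply/funext => s; rewrite big_nil.
rewrite big_cons -IH; have [Pi|Pi] := boolP (P i); last first.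
  congr (rl_integral _ _ _).
  by apply/funext => s; rewrite big_cons (negbTE Pi).
rewrite -rl_integralD; [|exact: ih|exact: rl_integrable_sum].
by congr (rl_integral _ _ _); apply/funext => s; rewrite big_cons Pi.
Qed.

Lemma le_rl_integral (R : realType) (a t : R) (h1 h2 : R -> R) : 0 < a ->
  rl_integrable a h1 t -> rl_integrable a h2 t ->
  (forall s, 0 < s -> s < t -> h1 s <= h2 s) ->
  rl_integral a h1 t <= rl_integral a h2 t.
Proof.
move=> a0 i1 i2 h12; apply: le_Rintegral => //.
move=> s; rewrite /= in_itv/= => /andP[s0 st].
by rewrite ler_wpM2l ?rl_kernel_ge0// h12.
Qed.

(** [rl_kernel_conv] at s = 0, where the integrand vanishes off ]0, t[. *)
Lemma integral_rl_kernel_conv0 (R : realType) (a b t : R) : 0 < a -> 0 < b ->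
  (\int[mu]_(s in `]0%R, t[) (rl_kernel a (t - s) * rl_kernel b s)%:E =
   (rl_kernel (a + b) t)%:E)%E.
Proof.
move=> a0 b0; transitivity (\int[mu]_u (rl_kernel a (t - u) * rl_kernel b (u - 0))%:E)%E; last first.
  by rewrite (rl_kernel_conv 0 t a0 b0) (subr0 t).
rewrite [LHS]integral_mkcond; apply: eq_integral => s _; rewrite patchE subr0.
case: ifPn; rewrite ?inE ?notin_setE/= in_itv/= => // /negP.
rewrite negb_and -!leNgt /rl_kernel /power_kernel subr_gt0 => /orP[s0|ts].
  by rewrite [0 < s]ltNge s0 mul0r mulr0.
by rewrite ltNge ts !mul0r.
Qed.

Lemma rl_integrable_kernel (R : realType) (a b t : R) : 0 < a -> 0 < b ->
  rl_integrable a (rl_kernel b) t.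
Proof.
move=> a0 b0; apply/integrableP; split.
  apply/measurable_EFinP; apply: measurable_funM; last first.
    by apply: measurable_funTS; exact: measurable_rl_kernel.
  by apply: measurable_funTS; exact: measurable_rl_kernel_sub.
apply: (@le_lt_trans _ _ (rl_kernel (a + b) t)%:E); last exact: ltry.
rewrite -(integral_rl_kernel_conv0 t a0 b0) le_eqVlt; apply/orP; left; apply/eqP.
by apply: eq_integral => s _; rewrite /= ger0_norm// mulr_ge0 ?rl_kernel_ge0.
Qed.

Lemma rl_integral_kernel (R : realType) (a b t : R) : 0 < a -> 0 < b ->
  rl_integral a (rl_kernel b) t = rl_kernel (a + b) t.
Proof.
by move=> a0 b0; rewrite /rl_integral /Rintegral integral_rl_kernel_conv0.
Qed.

(** The kernel of order 1 is 1 on ]0, t[, so [rl_integrable_kernel] already covers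
    constants. *)
Lemma rl_integrable_bounded (R : realType) (a t M : R) (h : R -> R) : 0 < a ->
  measurable_fun `]0, t[ h -> (forall s, 0 < s -> `|h s| <= M) ->
  rl_integrable a h t.
Proof.
move=> a0 mh hM.
have i1 := rl_integrableZ M (rl_integrable_kernel t a0 (ltr01 : 0 < 1 :> R)).
apply: le_integrable i1 => //.
  apply/measurable_EFinP; apply: measurable_funM => //.
  by apply: measurable_funTS; exact: measurable_rl_kernel_sub.
move=> s; rewrite /= in_itv/= => /andP[s0 st].
rewrite lee_fin rl_kernel1E s0 mulr1 normrM [leRHS]normrM; apply: ler_wpM2l => //.
by apply: le_trans (hM s s0) _; exact: ler_norm.
Qed.

(** The monomials of the Mittag-Leffler series. *)
Definition frac_monomial (R : realType) (a : R) (n : nat) (t : R) : R :=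
  t `^ (n%:R * a) / Gamma (n%:R * a + 1).

Lemma frac_monomialE (R : realType) (a : R) (n : nat) (t : R) : 0 < t ->
  frac_monomial a n t = rl_kernel (n%:R * a + 1) t.
Proof. by move=> t0; rewrite /frac_monomial /rl_kernel /power_kernel t0 addrK. Qed.

Lemma eq_rl_integrable (R : realType) (a t : R) (h1 h2 : R -> R) :
  (forall s, 0 < s -> s < t -> h1 s = h2 s) -> rl_integrable a h1 t -> rl_integrable a h2 t.
Proof.
move=> h12; apply: eq_integrable => // s; rewrite inE/= in_itv/= => /andP[s0 st].
by rewrite h12.
Qed.

Lemma eq_rl_integral (R : realType) (a t : R) (h1 h2 : R -> R) :
  (forall s, 0 < s -> s < t -> h1 s = h2 s) -> rl_integral a h1 t = rl_integral a h2 t.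
Proof.
move=> h12; apply: eq_Rintegral => // s; rewrite inE/= in_itv/= => /andP[s0 st].
by rewrite h12.
Qed.

Lemma rl_integrable_frac_monomial (R : realType) (a : R) n (t : R) : 0 < a ->
  rl_integrable a (frac_monomial a n) t.
Proof.
move=> a0; apply: (@eq_rl_integrable _ _ _ (rl_kernel (n%:R * a + 1))).
  by move=> s s0 _; rewrite frac_monomialE.
by apply: rl_integrable_kernel => //; rewrite ltr_wpDl// mulr_ge0// ltW.
Qed.

Lemma rl_integral_frac_monomial (R : realType) (a : R) n (t : R) : 0 < a -> 0 < t ->
  rl_integral a (frac_monomial a n) t = frac_monomial a n.+1 t.
Proof.
move=> a0 t0; have b0 : 0 < n%:R * a + 1 by rewrite ltr_wpDl// mulr_ge0// ltW.
transitivity (rl_integral a (rl_kernel (n%:R * a + 1)) t).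
  by apply: eq_rl_integral => s s0 _; exact: frac_monomialE.
rewrite (rl_integral_kernel t a0 b0) (frac_monomialE a n.+1 t0).
by congr rl_kernel; rewrite addrA -nat1r mulrDl mul1r.
Qed.

(** A finite combination of the monomials, encoded by the polynomial of its
    coefficients: fractional integration becomes multiplication by 'X
    ([rl_integral_frac_poly]). *)
Definition frac_poly (R : realType) (a : R) (q : {poly R}) (t : R) : R :=
  \sum_(i < size q) q`_i * frac_monomial a i t.

Lemma frac_polyE (R : realType) (a t : R) (q : {poly R}) (N : nat) :
  (size q <= N)%N -> frac_poly a q t = \sum_(i < N) q`_i * frac_monomial a i t.
Proof.
move=> qN; rewrite /frac_poly.
rewrite (big_ord_widen N (fun i => q`_i * frac_monomial a i t) qN) big_mkcond.
apply: eq_bigr => i _; case: ltnP => // qi.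
by rewrite nth_default// mul0r.
Qed.

Lemma frac_polyD (R : realType) (a t : R) (p q : {poly R}) :
  frac_poly a (p + q) t = frac_poly a p t + frac_poly a q t.
Proof.
rewrite (frac_polyE _ _ (size_polyD p q)) (frac_polyE _ _ (leq_maxl (size p) (size q))).
rewrite (frac_polyE _ _ (leq_maxr (size p) (size q))) -big_split/=.
by apply: eq_bigr => i _; rewrite coefD mulrDl.
Qed.

Lemma frac_polyZ (R : realType) (a t c : R) (p : {poly R}) :
  frac_poly a (c *: p) t = c * frac_poly a p t.
Proof.
rewrite (frac_polyE _ _ (size_scale_leq c p)) /frac_poly big_distrr/=.
by apply: eq_bigr => i _; rewrite coefZ -mulrA.
Qed.

Lemma frac_poly0 (R : realType) (a t : R) : frac_poly a 0 t = 0.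
Proof. by rewrite /frac_poly size_poly0 big_ord0. Qed.

Lemma frac_poly_sum (R : realType) (a t : R) (I : Type) (r : seq I) (P : pred I)
    (q : I -> {poly R}) :
  frac_poly a (\sum_(i <- r | P i) q i) t = \sum_(i <- r | P i) frac_poly a (q i) t.
Proof.
apply: (big_morph (fun q => frac_poly a q t)); last exact: frac_poly0.
by move=> p p'; rewrite frac_polyD.
Qed.

Lemma frac_polyC (R : realType) (a t c : R) : frac_poly a c%:P t = c.
Proof.
rewrite (frac_polyE _ _ (size_polyC_leq1 c)) big_ord1 coefC eqxx.
by rewrite /frac_monomial mul0r powRr0 add0r Gamma1 divr1 mulr1.
Qed.

Lemma rl_integrable_frac_poly (R : realType) (a t : R) (q : {poly R}) : 0 < a ->
  rl_integrable a (frac_poly a q) t.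
Proof.
move=> a0; apply: rl_integrable_sum => i _; apply: rl_integrableZ.
exact: rl_integrable_frac_monomial.
Qed.

Lemma rl_integral_frac_poly (R : realType) (a t : R) (q : {poly R}) :
  0 < a -> 0 < t ->
  rl_integral a (frac_poly a q) t = frac_poly a ('X * q) t.
Proof.
move=> a0 t0; rewrite rl_integral_sum; last first.
  by move=> i _; apply: rl_integrableZ; exact: rl_integrable_frac_monomial.
rewrite (@frac_polyE _ _ _ _ (size q).+1); last first.
  by rewrite (leq_trans (size_polyMleq _ _))// size_polyX.
rewrite big_ord_recl coefXM eqxx mul0r add0r; apply: eq_bigr => i _.
rewrite rl_integralZ; last exact: rl_integrable_frac_monomial.
by rewrite rl_integral_frac_monomial// coefXM.
Qed.

(** * Binomial moments of a truncated sequence *)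

Lemma Vandermonde_shift (n j r : nat) :
  ('C(n + j, r) = \sum_(m < r.+1) 'C(j, m) * 'C(n, r - m))%N.
Proof. by rewrite addnC -binomial.Vandermonde. Qed.

(** The coefficient of u^m in sum_j lambda_j (1 + u)^j. *)
Definition rate_binomial (R : realType) (k : nat) (lambda : nat -> R) (m : nat) : R :=
  \sum_(1 <= j < k.+1) lambda j * 'C(j, m)%:R.

Definition trunc_moment (R : realType) (q : nat -> R) (N r : nat) : R :=
  \sum_(n < N) 'C(n, r)%:R * q n.

(** The contribution to the binomial moment of order r of the jumps that lead from
    below the level N to N or beyond. *)
Definition boundary_flux (R : realType) (k : nat) (lambda q : nat -> R) (N r : nat) : R :=
  \sum_(1 <= j < k.+1) lambda j *
    \sum_(n < N | (N <= n + j)%N) 'C(n + j, r)%:R * q n.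

(** Vandermonde's identity, summed over the jump sizes. *)
Lemma shifted_moment (R : realType) (k : nat) (lambda q : nat -> R) (N r : nat) :
  \sum_(1 <= j < k.+1) lambda j * \sum_(n < N) 'C(n + j, r)%:R * q n =
  \sum_(m < r.+1) rate_binomial k lambda m * trunc_moment q N (r - m).
Proof.
transitivity (\sum_(1 <= j < k.+1) \sum_(m < r.+1)
    (lambda j * 'C(j, m)%:R) * trunc_moment q N (r - m)).
  apply: eq_bigr => j _.
  transitivity (lambda j * \sum_(m < r.+1) 'C(j, m)%:R * trunc_moment q N (r - m)).
    congr (_ * _); rewrite /trunc_moment; under [RHS]eq_bigr do rewrite big_distrr/=.
    rewrite exchange_big/=; apply: eq_bigr => n _.
    rewrite Vandermonde_shift natr_sum big_distrl/=; apply: eq_bigr => m _.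
    by rewrite natrM mulrA.
  by rewrite big_distrr/=; apply: eq_bigr => m _; rewrite mulrA.
by rewrite exchange_big/=; apply: eq_bigr => m _; rewrite /rate_binomial big_distrl.
Qed.

(** The gain term, reindexed by the state before the jump, is the sum in
    [shifted_moment] less the jumps that leave the truncation; the part m = 0 of
    that sum cancels the loss term. *)
Lemma moment_drift (R : realType) (k : nat) (lambda q : nat -> R) (N r : nat) :
  \sum_(n < N) 'C(n, r)%:R *
    (- (\sum_(1 <= j < k.+1) lambda j) * q n +
     \sum_(1 <= j < (minn n k).+1) lambda j * q (n - j)%N) =
  \sum_(m < r.+1 | (0 < m)%N) rate_binomial k lambda m * trunc_moment q N (r - m)
   - boundary_flux k lambda q N r.
Proof.
have E1 : \sum_(n < N) 'C(n, r)%:R * (\sum_(1 <= j < (minn n k).+1) lambda j * q (n - j)%N) =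
    \sum_(1 <= j < k.+1) lambda j *
      \sum_(n < N | (n + j < N)%N) 'C(n + j, r)%:R * q n.
  transitivity (\sum_(n < N) \sum_(1 <= j < k.+1 | (j <= n)%N)
     'C(n, r)%:R * (lambda j * q (n - j)%N)).
    apply: eq_bigr => n _; rewrite big_distrr/=.
    rewrite (big_nat_widen _ _ k.+1); last by rewrite ltnS geq_minr.
    rewrite big_nat_cond [RHS]big_nat_cond; apply: eq_bigl => j.
    by lia.
  rewrite (exchange_big_dep xpredT)//=; apply: eq_bigr => j _.
  rewrite big_distrr/= -(big_mkord (fun n => j <= n)%N
    (fun n => 'C(n, r)%:R * (lambda j * q (n - j)%N))).
  rewrite -(big_mkord (fun n => n + j < N)%N
    (fun n => lambda j * ('C(n + j, r)%:R * q n))).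
  have [Nj|jN] := leqP N j.
    rewrite [LHS]big_nat_cond [RHS]big_nat_cond !big_pred0//.
      by move=> n; lia.
    by move=> n; lia.
  rewrite (big_cat_nat (n := j)) ?(ltnW jN)//= big_nat_cond big_pred0 ?add0r; last by move=> n; lia.
  rewrite -{1}(add0n j) big_addn [RHS](big_cat_nat (n := (N - j)%N)) ?leq_subr//=.
  rewrite [X in _ + X]big_nat_cond [X in _ + X]big_pred0 ?addr0; last by move=> n; lia.
  rewrite big_nat_cond [RHS]big_nat_cond; apply: eq_big => n; first lia.
  by move=> _; rewrite addnK mulrCA.
have E2 : \sum_(1 <= j < k.+1) lambda j * \sum_(n < N) 'C(n + j, r)%:R * q n =
   \sum_(1 <= j < k.+1) lambda j *
      (\sum_(n < N | (n + j < N)%N) 'C(n + j, r)%:R * q n) +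
   boundary_flux k lambda q N r.
  rewrite /boundary_flux -big_split/=; apply: eq_bigr => j _; rewrite -mulrDr.
  congr (_ * _); rewrite (bigID (fun n : 'I_N => (n + j < N)%N))/=; congr (_ + _).
  by apply: eq_bigl => n; rewrite -leqNgt.
under eq_bigr do rewrite mulrDr; rewrite big_split/= E1.
have -> : \sum_(n < N) 'C(n, r)%:R * (- (\sum_(1 <= j < k.+1) lambda j) * q n) =
   - (rate_binomial k lambda 0 * trunc_moment q N r).
  rewrite /rate_binomial /trunc_moment big_distrr/= -[RHS]sumrN; apply: eq_bigr => n _.
  rewrite mulrCA mulNr; congr (- (_ * _)).
  by apply: eq_bigr => j _; rewrite bin0 mulr1.
move: E2; rewrite shifted_moment.
rewrite big_ord_recl subn0 [in X in _ -> _ = X - _]big_mkcond big_ord_recl/= add0r => E2.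
have -> : \sum_(i < r) (if (0 < bump 0 i)%N then rate_binomial k lambda (bump 0 i) *
   trunc_moment q N (r - bump 0 i) else 0) = \sum_(i < r)  rate_binomial k lambda (bump 0 i) *
   trunc_moment q N (r - bump 0 i) by [].
by move: E2; lra.
Qed.

Lemma boundary_flux_ge0 (R : realType) (k : nat) (lambda q : nat -> R) (N r : nat) :
  (forall j, (1 <= j <= k)%N -> 0 <= lambda j) -> (forall n, 0 <= q n) ->
  0 <= boundary_flux k lambda q N r.
Proof.
move=> hl hq; rewrite /boundary_flux big_nat; apply: sumr_ge0 => j jk.
by rewrite mulr_ge0 ?hl// sumr_ge0// => n _; rewrite mulr_ge0.
Qed.

Lemma mul_bin_split (x r : nat) :
  (x * 'C(x, r) = r * 'C(x, r) + r.+1 * 'C(x, r.+1))%N.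
Proof.
rewrite mul_bin_left -mulnDl; have [rx|xr] := leqP r x; first by rewrite subnKC.
by rewrite bin_small// !muln0.
Qed.

(** A jump that crosses N ends at some x = n + j >= N, and
    N binom(x, r) <= x binom(x, r) = r binom(x, r) + (r + 1) binom(x, r + 1):
    one more moment gains a factor 1/N. *)
Lemma boundary_flux_le (R : realType) (k : nat) (lambda q : nat -> R) (N r : nat) :
  (forall j, (1 <= j <= k)%N -> 0 <= lambda j) -> (forall n, 0 <= q n) ->
  N%:R * boundary_flux k lambda q N r <=
  r%:R * (\sum_(m < r.+1) rate_binomial k lambda m * trunc_moment q N (r - m)) +
  r.+1%:R * (\sum_(m < r.+2) rate_binomial k lambda m * trunc_moment q N (r.+1 - m)).
Proof.
move=> hl hq; rewrite -!shifted_moment /boundary_flux !big_distrr/= -big_split/=.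
apply: ler_sum_nat => j jk.
rewrite mulrCA [r%:R * _]mulrCA [r.+1%:R * _]mulrCA -mulrDr.
apply: ler_wpM2l; first by apply: hl; lia.
rewrite !big_distrr/= -big_split/= big_mkcond/=; apply: ler_sum => n _.
rewrite !mulrA -mulrDl -!natrM -natrD -mul_bin_split.
case: ifP => Nn; last by rewrite mulr_ge0.
by rewrite ler_wpM2r// ler_nat leq_mul2r Nn orbT.
Qed.

(** * Powers of the jump polynomial *)

Lemma coef_exp_eq (R : nzRingType) (A B : {poly R}) (r : nat) :
  (forall i, (i <= r)%N -> A`_i = B`_i) ->
  forall n i, (i <= r)%N -> (A ^+ n)`_i = (B ^+ n)`_i.
Proof.
move=> AB; elim=> [|n IH] i ir; first by rewrite !expr0.
rewrite !exprS !coefM; apply: eq_bigr => j _.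
by rewrite AB ?IH//; have := ltn_ord j; lia.
Qed.

(** Only the coefficients of degree at most r matter, so A may be truncated; then
    distribute the product of n copies over the sum. *)
Lemma coef_exp_composition (R : comNzRingType) (A : {poly R}) (n r : nat) :
  (A ^+ n)`_r = \sum_(m : {ffun 'I_n -> 'I_r.+1} | (\sum_i m i)%N == r)
    \prod_(l < n) A`_(m l).
Proof.
rewrite (@coef_exp_eq _ A (\poly_(i < r.+1) A`_i) r)//; last first.
  by move=> i ir; rewrite coef_poly ltnS ir.
rewrite -[X in _ ^+ X](card_ord n) -prodr_const poly_def.
rewrite bigA_distr_bigA coef_sum [RHS]big_mkcond/=; apply: eq_bigr => m _.
rewrite scaler_prod -expr_sum coefZ coefXn eq_sym.
by case: eqP => _; rewrite ?mulr1 ?mulr0.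
Qed.

Lemma coef_exp_low (R : nzRingType) (A : {poly R}) : A`_0 = 0 ->
  forall n r, (r < n)%N -> (A ^+ n)`_r = 0.
Proof.
move=> A0; elim=> // n IH r rn; rewrite exprS coefM big1// => j _.
have [->|j0] := eqVneq (j : nat) 0%N; first by rewrite A0 mul0r.
by rewrite IH ?mulr0//; have := ltn_ord j; lia.
Qed.

(** This is sum_j lambda_j ((1 + u)^j - 1), the exponent of the probability
    generating function at 1 + u of the compound Poisson process at time 1;
    jumps have size at most k, so the degree bound cuts nothing off. *)
Definition jump_poly (R : realType) (k : nat) (lambda : nat -> R) : {poly R} :=
  \poly_(m < k.+1) (rate_binomial k lambda m *+ (0 < m)%N).

Lemma coef_jump_poly (R : realType) (k : nat) (lambda : nat -> R) (m : nat) :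
  (jump_poly k lambda)`_m = rate_binomial k lambda m *+ (0 < m)%N.
Proof.
rewrite coef_poly; case: ltnP => // km.
rewrite /rate_binomial big_nat big1 ?mul0rn// => j jk.
by rewrite bin_small ?mulr0//; lia.
Qed.

(** The coefficients, in the monomials of the Mittag-Leffler series, of the
    binomial moment of order r. *)
Definition moment_poly (R : realType) (k : nat) (lambda : nat -> R) (r : nat) : {poly R} :=
  \poly_(n < r.+1) (jump_poly k lambda ^+ n)`_r.

Lemma coef_moment_poly (R : realType) (k : nat) (lambda : nat -> R) (r n : nat) :
  (moment_poly k lambda r)`_n = (jump_poly k lambda ^+ n)`_r.
Proof.
rewrite coef_poly; case: ltnP => // rn; rewrite coef_exp_low//.
by rewrite coef_jump_poly.
Qed.

(** Isolate one factor of the n-th power of the jump polynomial. *)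
Lemma moment_poly_rec (R : realType) (k : nat) (lambda : nat -> R) (r : nat) :
  moment_poly k lambda r = (r == 0)%N%:R%:P +
   \sum_(m < r.+1 | (0 < m)%N)
     rate_binomial k lambda m *: ('X * moment_poly k lambda (r - m)).
Proof.
apply/polyP => -[|n]; rewrite coef_moment_poly coefD coefC coef_sum/=.
  rewrite expr0 coef1 big1 ?addr0// => m _; by rewrite coefZ coefXM mulr0.
rewrite add0r exprS coefM [RHS]big_mkcond/=; apply: eq_bigr => m _.
rewrite coefZ coefXM/= coef_moment_poly coef_jump_poly.
by case: ifP; rewrite ?mulr1n// mulr0n mul0r.
Qed.

Lemma rate_binomialE (R : realType) (k : nat) (lambda : nat -> R) (m : nat) :
  rate_binomial k lambda m = ((m`!)%:R)^-1 * \sum_(1 <= j < k.+1) (j ^_ m)%:R * lambda j.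
Proof.
rewrite /rate_binomial big_distrr/=; apply: eq_bigr => j _.
rewrite -bin_ffact natrM [X in X * lambda j]mulrC -mulrA mulKf; first by rewrite mulrC.
by rewrite pnatr_eq0 -lt0n fact_gt0.
Qed.

(** The jump polynomial has no constant term, so only compositions into positive
    parts contribute. *)
Lemma coef_jump_poly_exp (R : realType) (k : nat) (lambda : nat -> R) (n r : nat) :
  (jump_poly k lambda ^+ n)`_r =
  \sum_(m : {ffun 'I_n -> 'I_r.+1} |
             [forall i, (0 < m i)%N] && ((\sum_i m i)%N == r))
     \prod_(l < n)
           (((m l)`!)%:R^-1 *
            \sum_(1 <= j < k.+1) (j ^_ (m l))%:R * lambda j).
Proof.
rewrite coef_exp_composition (bigID (fun m : {ffun 'I_n -> 'I_r.+1} => [forall i, (0 < m i)%N]))/=.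
rewrite [X in _ + X]big1 ?addr0.
  apply: eq_big => [m|m /andP[_ /forallP m0]]; first by rewrite andbC.
  by apply: eq_bigr => l _; rewrite coef_jump_poly m0 -rate_binomialE.
move=> m /andP[_ /forallPn[l]]; rewrite -leqNgt leqn0 => /eqP ml.
by apply/eqP/prodf_eq0; exists l => //; rewrite coef_jump_poly ml.
Qed.

(** * Convergence of the truncated moments *)

(** What the moment computation uses of the state probabilities. *)
Record fractional_volterra (R : realType) (a : R) (k : nat) (lambda : nat -> R)
    (p : nat -> R -> R) : Prop := FractionalVolterra {
  fv_order : 0 < a ;
  fv_rates : forall j, (1 <= j <= k)%N -> 0 <= lambda j ;
  fv_ge0 : forall n t, 0 <= p n t ;
  fv_integrable : forall n t, rl_integrable a (p n) t ;
  fv_equation : forall n t, 0 < t -> p n t = (n == 0)%N%:R +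
    rl_integral a (fun s => - (\sum_(1 <= j < k.+1) lambda j) * p n s +
       \sum_(1 <= j < (minn n k).+1) lambda j * p (n - j)%N s) t }.

Section MomentLimit.
Context (R : realType) (a : R) (k : nat) (lambda : nat -> R) (p : nat -> R -> R).
Context (fv : fractional_volterra a k lambda p).
Local Notation rb := (rate_binomial k lambda).
Local Notation truncated N r t := (trunc_moment (fun n => p n t) N r).
Local Notation full r := (frac_poly a (moment_poly k lambda r)).
Local Notation flux N r t := (boundary_flux k lambda (fun n => p n t) N r).

Lemma rate_binomial_ge0 m : 0 <= rb m.
Proof.
rewrite /rate_binomial big_nat; apply: sumr_ge0 => j jk.
by rewrite mulr_ge0// (fv_rates fv).
Qed.

Lemma trunc_moment_integrable N r t : rl_integrable a (fun s => truncated N r s) t.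
Proof. by apply: rl_integrable_sum => n _; apply: rl_integrableZ; exact: fv_integrable fv _ _. Qed.

Lemma boundary_flux_integrable N r t : rl_integrable a (fun s => flux N r s) t.
Proof.
apply: rl_integrable_sum => j _; apply: rl_integrableZ.
by apply: rl_integrable_sum => n _; apply: rl_integrableZ; exact: fv_integrable fv _ _.
Qed.

(** The level is N.+1 so that the initial state 0 lies below it. *)
Lemma trunc_moment_volterra N r t : 0 < t -> truncated N.+1 r t = (r == 0)%N%:R +
  rl_integral a (fun s => \sum_(m < r.+1 | (0 < m)%N) rb m * truncated N.+1 (r - m) s - flux N.+1 r s) t.
Proof.
move=> t0; rewrite {1}/trunc_moment.
under eq_bigr do rewrite (fv_equation fv)// mulrDr.
rewrite big_split/=; congr (_ + _).
  rewrite big_ord_recl/= mulr1 big1 ?addr0; last by move=> n _; rewrite mulr0.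
  by case: r.
have ip n s : rl_integrable a (p n) s by exact: fv_integrable fv _ _.
have id n : rl_integrable a (fun s : R => - (\sum_(1 <= j < k.+1) lambda j) * p n s +
       \sum_(1 <= j < (minn n k).+1) lambda j * p (n - j)%N s) t.
  apply: rl_integrableD; first exact: rl_integrableZ.
  by apply: rl_integrable_sum => j _; exact: rl_integrableZ.
under eq_bigr do rewrite -rl_integralZ//.
rewrite -rl_integral_sum; last by move=> n _; exact: rl_integrableZ.
by apply: eq_rl_integral => s _ _; exact: moment_drift.
Qed.

Lemma moment_poly_volterra r t : 0 < t -> full r t = (r == 0)%N%:R +
  rl_integral a (fun s => \sum_(m < r.+1 | (0 < m)%N) rb m * full (r - m) s) t.
Proof.
move=> t0; rewrite {1}moment_poly_rec frac_polyD frac_polyC; congr (_ + _).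
rewrite frac_poly_sum rl_integral_sum; last first.
  by move=> m _; apply: rl_integrableZ; apply: rl_integrable_frac_poly; exact: fv_order fv.
apply: eq_bigr => m _; rewrite frac_polyZ rl_integralZ; last first.
  by apply: rl_integrable_frac_poly; exact: fv_order fv.
by rewrite rl_integral_frac_poly//; exact: fv_order fv.
Qed.

Lemma moment_drift_integrable N r t : rl_integrable a
  (fun s => \sum_(m < r.+1 | (0 < m)%N) rb m * truncated N.+1 (r - m) s - flux N.+1 r s) t.
Proof.
have -> : (fun s => \sum_(m < r.+1 | (0 < m)%N) rb m * truncated N.+1 (r - m) s - flux N.+1 r s) =
    (fun s => \sum_(m < r.+1 | (0 < m)%N) rb m * truncated N.+1 (r - m) s + (-1) * flux N.+1 r s).
  by apply/funext => s; rewrite mulN1r.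
apply: rl_integrableD; last by apply: rl_integrableZ; exact: boundary_flux_integrable.
by apply: rl_integrable_sum => m _; apply: rl_integrableZ; exact: trunc_moment_integrable.
Qed.

(** Induction on r: dropping the flux and bounding the lower truncated moments
    turns [trunc_moment_volterra] into [moment_poly_volterra]. *)
Lemma trunc_moment_le r : forall N t, 0 < t -> truncated N.+1 r t <= full r t.
Proof.
have a0 := fv_order fv.
elim/ltn_ind: r => r IH N t t0.
rewrite trunc_moment_volterra// moment_poly_volterra// lerD2l; apply: le_rl_integral => //.
- exact: moment_drift_integrable.
- by apply: rl_integrable_sum => m _; apply: rl_integrableZ; exact: rl_integrable_frac_poly.
- move=> s s0 st; apply: (@le_trans _ _ (\sum_(m < r.+1 | (0 < m)%N) rb m * truncated N.+1 (r - m) s)).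
    rewrite gerBl boundary_flux_ge0//; first exact: fv_rates fv.
    by move=> n; exact: fv_ge0 fv _ _.
  apply: ler_sum => m m0; apply: ler_wpM2l; first exact: rate_binomial_ge0.
  by apply: IH => //; have := ltn_ord m; lia.
Qed.

(** The right-hand side of [boundary_flux_le] with the truncated moments replaced by
    their upper bounds, so that the bound no longer depends on N. *)
Definition error_poly r : {poly R} :=
  r%:R *: (\sum_(m < r.+1) rb m *: moment_poly k lambda (r - m)) +
  r.+1%:R *: (\sum_(m < r.+2) rb m *: moment_poly k lambda (r.+1 - m)).

Lemma boundary_flux_le_error N r t : 0 < t -> flux N.+1 r t <= frac_poly a (error_poly r) t / N.+1%:R.
Proof.
move=> t0; rewrite ler_pdivlMr// mulrC.
have h : forall r', \sum_(m < r'.+1) rb m * truncated N.+1 (r' - m) t <=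
    frac_poly a (\sum_(m < r'.+1) rb m *: moment_poly k lambda (r' - m)) t.
  move=> r'; rewrite frac_poly_sum; apply: ler_sum => m _; rewrite frac_polyZ.
  by apply: ler_wpM2l; [exact: rate_binomial_ge0|exact: trunc_moment_le].
apply: (le_trans (boundary_flux_le _ _ (fv_rates fv) _)).
  by move=> n; exact: fv_ge0 fv _ _.
by rewrite frac_polyD !frac_polyZ lerD// ler_wpM2l.
Qed.

(** Subtracting [trunc_moment_volterra] from [moment_poly_volterra], the gap at
    order r is the fractional integral of the gaps at lower orders and of the
    flux.  The bound must be of the form [frac_poly] to be integrable again. *)
Lemma moment_gap_le r : exists q : {poly R}, forall N t, 0 < t ->
  full r t - truncated N.+1 r t <= frac_poly a q t / N.+1%:R.
Proof.
have a0 := fv_order fv.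
elim/ltn_ind: r => r IH.
(* The premise m < r is kept under the existential to make the choice total. *)
have /choice[Q QP] : forall m, exists q : {poly R}, (m < r)%N -> forall N t, 0 < t ->
    full m t - truncated N.+1 m t <= frac_poly a q t / N.+1%:R.
  move=> m; have [mr|rm] := ltnP m r; last by exists 0.
  by have [q qP] := IH m mr; exists q.
exists ('X * (\sum_(m < r.+1 | (0 < m)%N) rb m *: Q (r - m)%N + error_poly r)) => N t t0.
rewrite lerBlDl trunc_moment_volterra// moment_poly_volterra// -addrA lerD2l.
rewrite -rl_integral_frac_poly// mulrC -rl_integralZ; last exact: rl_integrable_frac_poly.
have iS := moment_drift_integrable N r t.
rewrite -rl_integralD//; last by apply: rl_integrableZ; exact: rl_integrable_frac_poly.
apply: le_rl_integral => //.
- by apply: rl_integrable_sum => m _; apply: rl_integrableZ; exact: rl_integrable_frac_poly.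
- by apply: rl_integrableD => //; apply: rl_integrableZ; exact: rl_integrable_frac_poly.
move=> s s0 st.
rewrite frac_polyD frac_poly_sum mulrDr big_distrr/=.
have hB := boundary_flux_le_error N r s0.
have hm : \sum_(m < r.+1 | (0 < m)%N) rb m * full (r - m) s <=
    \sum_(m < r.+1 | (0 < m)%N) rb m * truncated N.+1 (r - m) s +
    \sum_(m < r.+1 | (0 < m)%N) N.+1%:R^-1 * frac_poly a (rb m *: Q (r - m)%N) s.
  rewrite -big_split/=; apply: ler_sum => m m0.
  rewrite frac_polyZ mulrCA -mulrDr; apply: ler_wpM2l; first exact: rate_binomial_ge0.
  rewrite -lerBlDl mulrC; apply: QP => //; have := ltn_ord m; lia.
apply: (le_trans hm); rewrite -addrA lerD2l addrCA lerDl addrC subr_ge0.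
by apply: (le_trans hB); rewrite mulrC.
Qed.

Lemma trunc_moment_cvg r t : 0 < t -> truncated N r t @[N --> \oo] --> full r t.
Proof.
move=> t0; have [q qP] := moment_gap_le r.
rewrite -cvg_shiftS.
apply: (@squeeze_cvgr _ _ _ _ (fun N => full r t - frac_poly a q t * N.+1%:R^-1) (fun=> full r t)).
- apply: nearW => N; rewrite trunc_moment_le// andbT.
  by rewrite lerBlDr -lerBlDl; exact: qP.
- rewrite -[X in _ --> X]subr0; apply: cvgB; first exact: cvg_cst.
  rewrite -[X in _ --> X](mulr0 (frac_poly a q t)); apply: cvgMr.
  exact: cvg_harmonic.
- exact: cvg_cst.
Qed.

End MomentLimit.

(** * The process *)

(** Split the sample space along the values of X. *)
Lemma nat_expectation (d : measure_display) (T : measurableType d) (R : realType)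
    (P : probability T R) (X : {RV P >-> nat}) (f : nat -> R) : (forall n, 0 <= f n) ->
  ('E_P[fun w => f (X w)] = \sum_(n <oo) (f n * fine (P (X @^-1` [set n])))%:E)%E.
Proof.
move=> f0; rewrite unlock.
have mX n : measurable (X @^-1` [set n]) by exact: measurable_funPTI.
have XT : [set: T] = \bigcup_n (X @^-1` [set n]).
  by apply/seteqP; split => // w _; exists (X w).
rewrite XT ge0_integral_bigcup//.
- apply: eq_eseriesr => n _.
  rewrite (eq_integral (cst (f n)%:E)); last by move=> w; rewrite inE/= => ->.
  by rewrite integral_cst//= EFinM fineK// fin_num_measure.
- rewrite -XT; apply/measurable_EFinP; apply: measurableT_comp => //.
- by move=> w _; rewrite lee_fin.
- by move=> i j _ _ [w [/= <- <-]].
Qed.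

Section GFCP.
Context (d : measure_display) (T : measurableType d) (R : realType)
  (P : probability T R) (alpha : R) (k : nat) (lambda : nat -> R) (M : R -> {RV P >-> nat}).

Lemma state_prob_ge0 n t : 0 <= state_prob M n t.
Proof. exact: fine_ge0. Qed.

Lemma state_prob_le1 n t : state_prob M n t <= 1.
Proof.
rewrite -lee_fin fineK ?fin_num_measure//; last exact: measurable_funPTI.
by apply: probability_le1; exact: measurable_funPTI.
Qed.

Lemma GFCP_volterra : 0 < alpha -> alpha <= 1 ->
  (forall j : nat, (1 <= j <= k)%N -> 0 < lambda j) ->
  is_GFCP alpha k lambda M ->
  fractional_volterra alpha k lambda (state_prob M).
Proof.
move=> a0 a1 hl [reg init eqn]; split => //.
- by move=> j /hl/ltW.
- by move=> n t; exact: state_prob_ge0.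
- move=> n t; apply: (@rl_integrable_bounded _ _ _ 1) => //.
    exact: locally_absolutely_continuous_measurable.
  by move=> s _; rewrite ger0_norm ?state_prob_ge0// state_prob_le1.
- by move=> n t t0; rewrite -init; exact: (caputo_volterra a0 a1 t0 (reg n) (eqn n)).
Qed.

Lemma factorial_moment_series r t :
  (('E_P[fun w => ((M t w) ^_ r)%:R] =
   \sum_(n <oo) ((n ^_ r)%:R * state_prob M n t)%:E)%E).
Proof. by rewrite (@nat_expectation _ _ _ _ _ (fun n => (n ^_ r)%:R)). Qed.

Lemma factorial_moment_poly r t : 0 < t ->
  fractional_volterra alpha k lambda (state_prob M) ->
  ('E_P[fun w => ((M t w) ^_ r)%:R] =
   ((r`!)%:R * frac_poly alpha (moment_poly k lambda r) t)%:E)%E.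
Proof.
move=> t0 fv; rewrite factorial_moment_series; apply/cvg_lim => //.
rewrite (_ : (fun N => _) = EFin \o
    (fun N => (r`!)%:R * trunc_moment (fun n => state_prob M n t) N r)); last first.
  apply/funext => N /=; rewrite sumEFin big_mkord; congr EFin.
  rewrite /trunc_moment big_distrr/=; apply: eq_bigr => n _.
  by rewrite mulrA -natrM mulnC bin_ffact.
apply/fine_cvgP; split; first exact: nearW.
by apply: cvgMr; exact: trunc_moment_cvg.
Qed.

Lemma factorial_moment0 r : (1 <= r)%N -> is_GFCP alpha k lambda M ->
  ('E_P[fun w => ((M 0 w) ^_ r)%:R] = 0)%E.
Proof.
move=> r0 [_ init _]; rewrite factorial_moment_series eseries0// => n _ _.
rewrite init; case: n => [|n]; last by rewrite mulr0.
by rewrite ffact_small// mul0r.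
Qed.

End GFCP.

(* A composition m_1 + ... + m_n = r into n positive parts is a function
   m : 'I_n -> 'I_r.+1 with positive values and sum r (each part is <= r). *)
Theorem proposition3p4 (R : realType) (d : measure_display)
    (T : measurableType d) (P : probability T R)
    (alpha : R) (k : nat) (lambda : nat -> R) (M : R -> {RV P >-> nat})
    (halpha0 : 0 < alpha) (halpha1 : alpha <= 1) (hk : (1 <= k)%N)
    (hlambda : forall j : nat, (1 <= j <= k)%N -> 0 < lambda j)
    (hM : is_GFCP alpha k lambda M)
    (r : nat) (hr : (1 <= r)%N) (t : R) (ht : 0 <= t) :
  ('E_P[fun w => ((M t w) ^_ r)%:R] =
   ((r`!)%:R *
    \sum_(1 <= n < r.+1)
      (t `^ (n%:R * alpha) / Gamma (n%:R * alpha + 1) *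
       \sum_(m : {ffun 'I_n -> 'I_r.+1} |
             [forall i, (0 < m i)%N] && ((\sum_i m i)%N == r))
         \prod_(l < n)
           (((m l)`!)%:R^-1 *
            \sum_(1 <= j < k.+1) (j ^_ (m l))%:R * lambda j)))%:E)%E.
Proof.
(* At t = 0 the Volterra equation is not available, and both sides vanish. *)
move: ht; rewrite le_eqVlt => /predU1P[<-|t0].
  rewrite (factorial_moment0 hr hM) big_nat big1 ?mulr0// => n /andP[n0 _].
  by rewrite powR0 ?mul0r// mulf_neq0 ?gt_eqF// ltr0n.
have fv := GFCP_volterra halpha0 halpha1 hlambda hM.
rewrite (factorial_moment_poly r t0 fv); congr (_ * _)%:E.
rewrite (frac_polyE _ _ (size_poly _ _)).
rewrite -(big_mkord xpredT (fun i => (moment_poly k lambda r)`_i * frac_monomial alpha i t)).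
rewrite big_ltn// coef_moment_poly expr0 coef1 gtn_eqF// mul0r add0r.
apply: eq_bigr => n _.
by rewrite coef_moment_poly coef_jump_poly_exp mulrC.
Qed.
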